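(* Let $n\ge 2$ and $k\in\mathbb{N}$. The fusion rings $R_{2k+1}(A_{2n}^{(2)})$ and $R_k(C_n^{(1)})$ are isomorphic as rings with distinguished bases; that is, there is a $\mathbb{C}$-algebra isomorphism $R_{2k+1}(A_{2n}^{(2)})\to R_k(C_n^{(1)})$ which maps the basis $\{\mathring{\chi}_\lambda\mid\lambda\in P_{2k+1}(A_{2n}^{(2)})\}$ bijectively onto the basis $\{\mathring{\chi}_\lambda\mid\lambda\in P_k(C_n^{(1)})\}$.
   Context: For both affine types $A=A_{2n}^{(2)}$ and $A=C_n^{(1)}$ (Kac's notation), deleting the vertex $0$ (Kac's numbering) leaves the simple Lie algebra $\mathring{\mathfrak{g}}$ of type $C_n$, with Cartan subalgebra $\mathring{\mathfrak{h}}$. The dual Coxeter number is $\check{h}=2n+1$ for $A_{2n}^{(2)}$ and $\check{h}=n+1$ for $C_n^{(1)}$. Let $\mathring{P}\subset\mathring{\mathfrak{h}}^*$ be the weight lattice of $\mathring{\mathfrak{g}}$, $\mathring{P}^+$ the dominant weights, $\mathring{\rho}$ the sum of the fundamental weights, $\theta$ the highest root, and $\mathring{W}$ the Weyl group with length function $\ell$. Kac's normalized invariant form $(\cdot|\cdot)$ of $\mathfrak{g}(A)$, restricted to $\mathring{\mathfrak{h}}$ and transported to $\mathring{\mathfrak{h}}^*$ by the induced isomorphism $\kappa:\mathring{\mathfrak{h}}\to\mathring{\mathfrak{h}}^*$, is the $\mathring{W}$-invariant form with $(\theta|\theta)=4$ for $A=A_{2n}^{(2)}$ and $(\theta|\theta)=2$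 for $A=C_n^{(1)}$. Put $\check{\theta}=\kappa^{-1}(\theta)$ (it depends on $A$). For a level $m\in\mathbb{N}$, let $P_m(A)=\{\lambda\in\mathring{P}^+ : \langle\lambda,\check{\theta}\rangle\le m\}$. Let $\mathring{T}=\mathrm{Hom}(\mathring{P},\mathbb{C}^\times)$, write $\mu(t):=t(\mu)$ for $\mu\in\mathring{P}$, $t\in\mathring{T}$, and let $\Sigma_m(A)=\{e^{\frac{2\pi i}{m+\check{h}}(\mathring{\rho}+\lambda|\cdot)}\in\mathring{T} : \lambda\in P_m(A)\}$. $R_m(A)$ is the commutative ring of $\mathbb{C}$-valued functions on $\Sigma_m(A)$. For $\lambda\in P_m(A)$, $t\in\Sigma_m(A)$: $J_\lambda(t)=\sum_{w\in\mathring{W}}(-1)^{\ell(w)}\,w(\lambda+\mathring{\rho})(t)$ and $\mathring{\chi}_\lambda(t)=J_\lambda(t)/J_0(t)$. The functions $\mathring{\chi}_\lambda$, $\lambda\in P_m(A)$, form a $\mathbb{C}$-basis of $R_m(A)$; the fusion ring is by definition the ring $R_m(A)$ together with this basis. *)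

(* Defs.v *)
From HB Require Import structures.
From mathcomp Require Import all_boot all_order all_algebra.
From mathcomp Require Import complex.
From mathcomp Require Import all_classical all_reals all_analysis.
From mathcomp Require Import ring.

Set Implicit Arguments.
Unset Strict Implicit.
Unset Printing Implicit Defensive.

Import Order.TTheory GRing.Theory Num.Theory.

Local Open Scope classical_set_scope.
Local Open Scope complex_scope.
Local Open Scope ring_scope.

Inductive affine_type := A2n2 | Cn1.

Definition dual_coxeter (n : nat) (A : affine_type) : nat :=
  match A with A2n2 => (2 * n).+1 | Cn1 => n.+1 end.

(* (theta|theta) for Kac's normalized invariant form *)
Definition theta_sqnorm (A : affine_type) : nat :=
  match A with A2n2 => 4%N | Cn1 => 2%N end.

Section RootSystem.
Variable n : nat.

(* The entry (i, j) is the pairing of alpha_j with the coroot of alpha_i; the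
   nodes 1, ..., n are shifted to 0, ..., n - 1, and the last simple root is
   the long one. *)
Definition cartanC : 'M[int]_n :=
  \matrix_(i, j)
    if i == j then 2
    else if i.+1 == j then (if j.+1 == n then - 2 else - 1)
    else if j.+1 == i then - 1
    else 0.

(* Weights are written in the basis of fundamental weights, so that the i-th
   coordinate of a weight is its pairing with the i-th simple coroot. *)
Local Notation weight := 'rV[int]_n.

Definition simple_root (i : 'I_n) : weight := \row_j cartanC j i.

Definition fund_weight (i : 'I_n) : weight := delta_mx 0 i.

Definition rho : weight := \sum_i fund_weight i.

Definition dominant : set weight := [set la : weight | forall i, 0 <= la 0 i].

(* Linear maps act on row vectors by multiplication on the right. *)
Definition simple_refl (i : 'I_n) : 'M[int]_n :=
  1%:M - delta_mx i (0 : 'I_1) *m simple_root i.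

Lemma simple_reflE (i : 'I_n) (la : weight) :
  la *m simple_refl i = la - la 0 i *: simple_root i.
Proof.
rewrite /simple_refl mulmxBr mulmx1 mulmxA; congr (_ - _).
rewrite -colE; apply/rowP=> j.
by rewrite !mxE big_ord1 !mxE.
Qed.

Definition word_mx (s : seq 'I_n) : 'M[int]_n :=
  \big[mulmx/1%:M]_(i <- s) simple_refl i.

Definition weyl : set 'M[int]_n := range word_mx.

Definition is_length (w : 'M[int]_n) (l : nat) : Prop :=
  (exists2 s, size s = l & word_mx s = w) /\
  (forall s, word_mx s = w -> (l <= size s)%N).

Definition weyl_length (w : 'M[int]_n) : nat := xget 0%N (is_length w).

Definition root_set : set weight :=
  [set b : weight | exists i, exists2 w, weyl w & b = simple_root i *m w].

Definition is_highest_root (theta : weight) : Prop :=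
  root_set theta /\
  forall b, root_set b ->
    exists c : 'I_n -> nat, theta - b = \sum_i simple_root i *+ c i.

Variable R : realType.
Local Notation C := R[i].

(* The dual of the Cartan subalgebra, in the basis of fundamental weights, and
   the Cartan subalgebra, in the dual basis of simple coroots. *)
Local Notation cartan_dual := 'rV[C]_n.
Local Notation cartan_sub := 'cV[C]_n.

Definition wt (la : weight) : cartan_dual := map_mx intr la.

Definition pairing (la : cartan_dual) (x : cartan_sub) : C := (la *m x) 0 0.

(* The bilinear form on the dual with Gram matrix G on fundamental weights. *)
Definition inv_form (G : 'M[C]_n) (la mu : cartan_dual) : C :=
  (la *m G *m mu^T) 0 0.

Definition is_normalized_form (A : affine_type) (theta : weight)
    (G : 'M[C]_n) : Prop :=
  [/\ forall la mu, inv_form G la mu = inv_form G mu la,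
      forall w, weyl w -> forall la mu : cartan_dual,
        inv_form G (la *m map_mx intr w) (mu *m map_mx intr w) = inv_form G la mu
    & inv_form G (wt theta) (wt theta) = (theta_sqnorm A)%:R].

(* The element kappa_inv G mu is characterized by
   pairing la (kappa_inv G mu) = inv_form G la mu for all la. *)
Definition kappa_inv (G : 'M[C]_n) (mu : cartan_dual) : cartan_sub :=
  G *m mu^T.

(* The order of R[i] compares numbers with equal imaginary parts; here both
   sides are real. *)
Definition level_weights (theta : weight) (G : 'M[C]_n) (m : nat) :
    set weight :=
  [set la | dominant la /\ pairing (wt la) (kappa_inv G (wt theta)) <= m%:R].

Definition cexp (z : C) : C :=
  let: a +i* b := z in (expR a * cos b) +i* (expR a * sin b).

Lemma cexp_neq0 (z : C) : cexp z != 0.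
Proof.
case: z => a b; rewrite eq_complex /= !mulf_eq0 !(gt_eqF (expR_gt0 _)) /=.
apply/negP=> /andP[/eqP c0 /eqP s0].
have := cos2Dsin2 b; rewrite c0 s0 expr0n addr0 => /eqP.
by rewrite eq_sym oner_eq0.
Qed.

Lemma cexpD (x y : C) : cexp (x + y) = cexp x * cexp y.
Proof.
case: x y => [a b] [c d]; rewrite /cexp /= expRD cosD sinD.
by apply/eqP; rewrite eq_complex /=; apply/andP; split; apply/eqP; ring.
Qed.

Record torus := Torus {
  torus_val :> weight -> C;
  torus_neq0 : forall mu, torus_val mu != 0;
  torusD : forall mu nu : weight,
    torus_val (mu + nu) = torus_val mu * torus_val nu }.

Definition exp_form_fun (G : 'M[C]_n) (c : C) (nu mu : weight) : C :=
  cexp (c * inv_form G (wt nu) (wt mu)).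

Lemma exp_form_neq0 G c nu mu : exp_form_fun G c nu mu != 0.
Proof. exact: cexp_neq0. Qed.

Lemma exp_formD G c nu mu1 mu2 : exp_form_fun G c nu (mu1 + mu2) =
  exp_form_fun G c nu mu1 * exp_form_fun G c nu mu2.
Proof.
rewrite /exp_form_fun -cexpD -mulrDr; congr (cexp (_ * _)).
by rewrite /inv_form /wt map_mxD linearD /= mulmxDr mxE.
Qed.

Definition exp_form (G : 'M[C]_n) (c : C) (nu : weight) : torus :=
  Torus (exp_form_neq0 G c nu) (exp_formD G c nu).

Definition Sigma (A : affine_type) (theta : weight) (G : 'M[C]_n) (m : nat) :
    set torus :=
  [set exp_form G (2%:R * (pi : R)%:C * 'i%C / (m + dual_coxeter n A)%:R)
         (rho + la) | la in level_weights theta G m].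

Definition J (la : weight) (t : torus) : C :=
  \sum_(w \in weyl) (-1) ^+ weyl_length w * t ((la + rho) *m w).

(* The pointwise ring structure on functions is the library's. *)
Definition fusion_ring (A : affine_type) (theta : weight) (G : 'M[C]_n)
  (m : nat) := set_type (Sigma A theta G m) -> C^o.

HB.instance Definition _ A theta G m :=
  GRing.ComPzRing.on (fusion_ring A theta G m).
HB.instance Definition _ A theta G m :=
  GRing.Lmodule.on (fusion_ring A theta G m).

Definition chi A theta G m (la : weight) : fusion_ring A theta G m :=
  fun t => J la (val t) / J 0 (val t).

Definition fusion_basis A theta G m : set (fusion_ring A theta G m) :=
  [set @chi A theta G m la | la in level_weights theta G m].

End RootSystem.

Arguments chi {n R} A theta G m la.
Arguments fusion_basis {n R} A theta G m.

(* Main.v *)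
(* The invariant symmetric form is unique up to a scalar, so the two normalized
   forms satisfy (.|.)_A = 2 (.|.)_C.  As m + h is 2(k + n + 1) for A and
   k + n + 1 for C, the characters exp(2 pi i (rho + la|.) / (m + h)) are the
   same in both cases, and so are the level conditions: (la|theta)_C is an
   integer, and 2z <= 2k + 1 means z <= k.  Hence the two rings consist of
   functions on the same set, with the same basis. *)
Require Import Defs.
From mathcomp Require Import all_boot all_order all_algebra.
From mathcomp Require Import complex.
From mathcomp Require Import all_classical all_reals all_analysis.
From mathcomp Require Import ring zify.

Import Order.TTheory GRing.Theory Num.Theory.

Local Open Scope classical_set_scope.
Local Open Scope complex_scope.
Local Open Scope ring_scope.

(** Each simple reflection is an involution, so reversing a word inverts its product; as [weyl] is
    defined by words, this yields inverses inside it. *)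
Lemma word_mx_revK n (s : seq 'I_n) : word_mx s *m word_mx (rev s) = 1%:M.
Proof.
have reflK (i : 'I_n) : simple_refl i *m simple_refl i = 1%:M.
  apply/row_matrixP => j; rewrite row_mul !rowE mulmx1 !simple_reflE.
  move: (delta_mx 0 j) => x.
  have : simple_root i 0 i = 2 by rewrite !mxE eqxx.
  move: (simple_root i) => a a2.
  have -> : (x - x 0 i *: a) 0 i = - x 0 i.
    by rewrite !mxE a2; ring.
  by rewrite scaleNr opprK subrK.
have prodE (t : seq 'I_n) : word_mx t = \prod_(i <- t) simple_refl i by [].
rewrite !prodE; elim: s => [|i s IH]; first by rewrite !big_nil mulmx1.
rewrite rev_cons -cats1 big_cat big_cons big_seq1 /= -!mulmxE.
by rewrite mulmxA -(mulmxA (simple_refl i)) IH mulmx1.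
Qed.

Lemma weyl_right_inv {n} (w : 'M[int]_n) :
  weyl w -> exists2 v, weyl v & w *m v = 1%:M.
Proof.
case=> s _ <-; exists (word_mx (rev s)); last exact: word_mx_revK.
by exists (rev s).
Qed.

Lemma weyl_simple_refl {n} (i : 'I_n) : weyl (simple_refl i).
Proof. by exists [:: i] => //; rewrite /word_mx big_cons big_nil mulmx1. Qed.

(* Multiplying the Cartan matrix on the left by the Gram matrix min(i, j) of the
   fundamental weights [e_1 + ... + e_i] gives half the diagonal of squared root
   lengths. *)
Lemma cartanC_unit {F : numFieldType} n :
  map_mx intr (cartanC n) \in (unitmx : pred 'M[F]_n).
Proof.
set M := map_mx intr (cartanC n).
pose K : 'M[F]_n := \matrix_(i, j) (minn i j).+1%:R.
pose D : 'M[F]_n := diag_mx (\row_i (if i.+1 == n then 2 else 1)).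
have KM : K *m M = D.
  apply/matrixP => i k; rewrite !mxE.
  (* Column [k] of the Cartan matrix is supported on the rows [k], [k - 1] and [k + 1]; one
     indicator term for each lets every sum collapse to at most one summand. The guard [0 < k] is
     there because [k.-1] is 0 at [k = 0]; the factor 2 at [k.+1 == n] comes from the entry -2 in
     the last column. *)
  have E (j : 'I_n) : K i j * M j k =
      (if j == k :> nat then (minn i j).+1%:R * 2 else 0)
    - (if j == k.-1 :> nat then if (0 < k)%N then
         (minn i j).+1%:R * (if k.+1 == n then 2 else 1) else 0 else 0)
    - (if j == k.+1 :> nat then (minn i j).+1%:R else 0).
    rewrite !mxE -val_eqE /=.
    have [->|jk] := eqVneq (j : nat) k.
      have -> : (k == k.+1 :> nat) = false by lia.
      have -> : (if k == k.-1 :> nat then if (0 < k)%N then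
         (minn i k).+1%:R * (if k.+1 == n then 2 else 1) else 0 else 0) = 0 :> F.
        by case: (k : nat) => [|m] //=; case: eqP => //; lia.
      by rewrite !subr0.
    have [jk1|jk1] := eqVneq j.+1 (k : nat).
      rewrite -jk1 /= eqxx; have -> : (j == j.+2 :> nat) = false by lia.
      case: ifP => _; ring.
    have -> : (if j == k.-1 :> nat then if (0 < k)%N then
         (minn i j).+1%:R * (if k.+1 == n then 2 else 1) else 0 else 0) = 0 :> F.
      by case: eqP => // ?; case: ifP => //; lia.
    rewrite eq_sym; case: eqP => _; ring.
  rewrite (eq_bigr _ (fun j _ => E j)) !sumrB -!big_mkcond /=.
  rewrite (big_ord1_eq _ (fun j => (minn i j).+1%:R * 2)).
  rewrite (big_ord1_eq _ (fun j => if (0 < k)%N then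
      (minn i j).+1%:R * (if k.+1 == n then 2 else 1) else 0)).
  rewrite (big_ord1_eq _ (fun j => (minn i j).+1%:R)).
  rewrite ltn_ord -val_eqE /=.
  have -> : (k.-1 < n)%N by move: (ltn_ord k); lia.
  have ltin := ltn_ord i; have ltkn := ltn_ord k.
  move: (nat_of_ord i) (nat_of_ord k) ltin ltkn {E} => {}i {}k ltin ltkn.
  case: (eqVneq k.+1 n) ltin ltkn => [<-|kn] ltin ltkn.
    rewrite ltnn subr0 (_ : minn i k = i); last by lia.
    have [->|ik] := eqVneq i k.
      rewrite eqxx mulr1n; case: k {ltin ltkn} => [|k] /=; first by ring.
      by rewrite (_ : minn k.+1 k = k); [ring | lia].
    rewrite (_ : (0 < k)%N); last by lia.
    by rewrite (_ : minn i k.-1 = i) ?mulr0n; [ring | lia].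
  rewrite (_ : (k.+1 < n)%N); last by lia.
  have [lt_ik|lt_ki|ik] := ltngtP i k; rewrite ?mulr0n ?mulr1n.
  - rewrite (_ : (0 < k)%N); last by lia.
    rewrite (_ : minn i k.-1 = i); last by lia.
    by rewrite (_ : minn i k.+1 = i); [ring | lia].
  - case: k lt_ki {ltkn kn} => [|k] lt_ki /=.
      by rewrite (_ : minn i 1 = 1%N); [ring | lia].
    by rewrite (_ : minn i k = k) 1?(_ : minn i k.+2 = k.+2); [ring | lia | lia].
  - subst i; rewrite (negbTE kn) (_ : minn k k.+1 = k); last by lia.
    case: k {ltin ltkn kn} => [|k] /=; first by ring.
    by rewrite (_ : minn k.+1 k = k); [ring | lia].
have : K *m M \in unitmx.
  rewrite KM unitmxE det_diag unitfE.
  by apply/prodf_neq0 => i _; rewrite mxE; case: ifP => _; rewrite ?pnatr_eq0 ?oner_eq0.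
by rewrite unitmx_mul => /andP[].
Qed.

Section InvariantForm.
Context {R : realType} {n : nat}.
Implicit Types (G H : 'M[R[i]]_n) (x y : 'rV[R[i]]_n).

Definition weyl_invariant G := forall w : 'M[int]_n, weyl w ->
  forall x y, inv_form G (x *m map_mx intr w) (y *m map_mx intr w) =
    inv_form G x y.

Lemma inv_formBl G x1 x2 y :
  inv_form G (x1 - x2) y = inv_form G x1 y - inv_form G x2 y.
Proof. by rewrite /inv_form !mulmxBl !mxE. Qed.

Lemma inv_formZl G a x y : inv_form G (a *: x) y = a * inv_form G x y.
Proof. by rewrite /inv_form -!scalemxAl !mxE. Qed.

Lemma inv_formNr G x y : inv_form G x (- y) = - inv_form G x y.
Proof. by rewrite /inv_form linearN mulmxN mxE. Qed.

Lemma inv_form_combl a G b H x y : inv_form (a *: G - b *: H) x y =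
  a * inv_form G x y - b * inv_form H x y.
Proof.
by rewrite /inv_form mulmxBr mulmxBl -!scalemxAr -!scalemxAl !mxE.
Qed.

Lemma wt_simple_root i :
  wt R (simple_root i) = \row_j (map_mx intr (cartanC n)) j i.
Proof. by apply/rowP => j; rewrite !mxE. Qed.

Lemma map_simple_refl x (i : 'I_n) :
  x *m map_mx intr (simple_refl i) = x - x 0 i *: wt R (simple_root i).
Proof.
rewrite /simple_refl map_mxB map_mxM map_mx1 map_delta_mx mulmxBr mulmx1 mulmxA.
rewrite -colE; congr (_ - _); apply/rowP => j.
by rewrite !mxE big_ord1 !mxE.
Qed.

(** The reflection sends the simple root a to -a, so invariance gives (x|a) = -(x|a) + x_i (a|a).
    There is no division by (a|a), since the isotropic case is used below. *)
Lemma inv_form_simple_root G x (i : 'I_n) : weyl_invariant G ->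
  inv_form G x (wt R (simple_root i)) *+ 2 =
  x 0 i * inv_form G (wt R (simple_root i)) (wt R (simple_root i)).
Proof.
set a := wt R (simple_root i) => Ginv.
have aN : a *m map_mx intr (simple_refl i) = - a.
  rewrite map_simple_refl -/a (_ : a 0 i = 2); last by rewrite !mxE eqxx.
  by rewrite scaler_nat mulr2n opprD addNKr.
have := Ginv _ (weyl_simple_refl i) x a.
rewrite aN map_simple_refl -/a inv_formNr inv_formBl inv_formZl => E.
by rewrite mulr2n -{1}E; ring.
Qed.

(* Invariance under two adjacent simple reflections ties their root lengths, so
   by connectedness of the Dynkin diagram all simple roots become isotropic and
   the form kills them. *)
Lemma inv_form_root0 G (i : 'I_n) :
    (forall x y, inv_form G x y = inv_form G y x) -> weyl_invariant G ->
  inv_form G (wt R (simple_root i)) (wt R (simple_root i)) = 0 -> G = 0.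
Proof.
move=> Gsym Ginv.
pose q j := inv_form G (wt R (simple_root j)) (wt R (simple_root j)).
(* Twice the form on two simple roots, computed in both orders: the squared lengths symmetrize the
   Cartan matrix. *)
have qC (j l : 'I_n) :
    (cartanC n l j)%:~R * q l = (cartanC n j l)%:~R * q j.
  have := inv_form_simple_root _ (wt R (simple_root j)) l Ginv.
  rewrite Gsym (inv_form_simple_root _ _ _ Ginv) !mxE => E.
  by rewrite /q E.
have qS (j l : 'I_n) : l = j.+1 :> nat -> (q l == 0) = (q j == 0).
  move=> lj; have := qC j l; rewrite !mxE -!val_eqE /= lj eqxx.
  rewrite (_ : (j.+1 == j) = false); last by lia.
  rewrite (_ : (j.+2 == j) = false); last by lia.
  rewrite (_ : (j == j.+1 :> nat) = false); last by lia.
  move=> E; apply/eqP/eqP => q0; move: E; rewrite q0 mulr0; last first.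
    by move/eqP; rewrite mulf_eq0 intr_eq0 => /eqP.
  by move/esym/eqP; rewrite mulf_eq0 intr_eq0; case: ifP => _ /eqP.
have q_const m (lt_m : (m < n)%N) (lt_0 : (0 < n)%N) :
    (q (Ordinal lt_m) == 0) = (q (Ordinal lt_0) == 0).
  elim: m lt_m => [|m IH] lt_m; first by congr (q _ == 0); apply: val_inj.
  by rewrite (qS (Ordinal (ltnW lt_m))).
move=> /eqP qi0.
have q0 j : q j = 0.
  have n_gt0 : (0 < n)%N by apply: leq_ltn_trans (ltn_ord i).
  apply/eqP; case: j => j ltj; rewrite (q_const _ _ n_gt0).
  by case: i qi0 => i lti; rewrite -/(q _) (q_const _ _ n_gt0).
(* The columns of [cartanC] are the simple roots, so the entries of this product are the values of
   the form on a fundamental weight and a simple root. *)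
suff GM0 : G *m map_mx intr (cartanC n) = 0.
  by rewrite -[G](mulmxK (cartanC_unit n)) GM0 mul0mx.
apply/matrixP => j l; have := inv_form_simple_root _ (delta_mx 0 j) l Ginv.
rewrite -/(q l) q0 mulr0 => /eqP; rewrite mulrn_eq0 /= => /eqP E.
rewrite [RHS]mxE -[RHS]E /inv_form -rowE -row_mul wt_simple_root !mxE.
by apply: eq_bigr => p _; rewrite !mxE.
Qed.

(* Since (theta|theta) = 2, the root theta corresponds to its own coroot under
   the form. *)
Lemma inv_form_root_int G (theta la : 'rV[int]_n) :
    weyl_invariant G -> root_set theta ->
    inv_form G (wt R theta) (wt R theta) = 2%:R ->
  exists z : int, inv_form G (wt R la) (wt R theta) = z%:~R.
Proof.
move=> Ginv [i [w Ww ->]]; rewrite /wt map_mxM (Ginv _ Ww) => qi.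
have [v Wv wv] := weyl_right_inv _ Ww.
(* Applying [v], the inverse of [w], turns [theta] into [simple_root i]; the value is then a
   coordinate of an integral weight. *)
exists ((la *m v) 0 i).
rewrite -(Ginv _ Wv) -mulmxA -!map_mxM wv mulmx1.
apply: (@mulIf _ 2%:R); first by rewrite pnatr_eq0.
rewrite mulr_natr; apply: etrans (inv_form_simple_root _ _ i Ginv) _.
by congr (_ * _); [rewrite mxE | exact: qi].
Qed.

(** The form with matrix [GA - 2 GC] is again symmetric and invariant, and [theta] is isotropic for
    it since 4 - 2 * 2 = 0. As [theta] is conjugate to a simple root, [inv_form_root0] makes this
    form vanish. *)
Lemma normalized_form_double (theta : 'rV[int]_n) (GA GC : 'M[R[i]]_n) :
    root_set theta -> is_normalized_form A2n2 theta GA ->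
  is_normalized_form Cn1 theta GC -> GA = 2%:R *: GC.
Proof.
move=> [i [w Ww theta_def]] [symA invA nA] [symC invC nC].
apply/eqP; rewrite -subr_eq0 -[GA]scale1r; apply/eqP.
apply: (@inv_form_root0 _ i).
- by move=> x y; rewrite !inv_form_combl symA symC.
- by move=> v Wv x y; rewrite !inv_form_combl invA// invC.
rewrite inv_form_combl -(invA _ Ww) -(invC _ Ww) /wt -!map_mxM -theta_def.
by rewrite nA nC mul1r -natrM subrr.
Qed.

End InvariantForm.

Lemma torus_eq {R : realType} n (s t : torus n R) :
  torus_val s =1 torus_val t -> s = t.
Proof.
case: s t => [s s0 sD] [t t0 tD] /= /funext st; subst t.
by congr Torus; apply: Prop_irrelevance.
Qed.

(** Equal sets of torus points need not give convertible function types, so the isomorphism is the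
    pullback along a cast between the sets. It preserves characters because [J] depends only on the
    weight and the torus point, not on the form. *)
Lemma fusion_ring_transport {R : realType} {n m m'} {A A'} (theta : 'rV[int]_n)
    (G G' : 'M[R[i]]_n) :
    level_weights theta G m = level_weights theta G' m' ->
    Sigma A theta G m = Sigma A' theta G' m' ->
  exists phi : fusion_ring A theta G m -> fusion_ring A' theta G' m',
    [/\ linear phi, GRing.monoid_morphism phi, bijective phi
      & set_bij (fusion_basis A theta G m) (fusion_basis A' theta G' m') phi].
Proof.
move=> eqL eqS.
have cast (S S' : set (torus n R)) : S = S' ->
    {c : S' -> S & forall t, val (c t) = val t}.
  by move=> ->; exists id.
have [c cE] := cast _ _ eqS; have [d dE] := cast _ _ (esym eqS).
have cK : cancel c d by move=> t; apply: val_inj; rewrite dE cE.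
have dK : cancel d c by move=> t; apply: val_inj; rewrite cE dE.
pose phi (f : fusion_ring A theta G m) : fusion_ring A' theta G' m' :=
  fun t => f (c t).
pose psi (f : fusion_ring A' theta G' m') : fusion_ring A theta G m :=
  fun t => f (d t).
have phiK : cancel phi psi by move=> f; apply/funext => t; rewrite /phi /psi dK.
have psiK : cancel psi phi by move=> f; apply/funext => t; rewrite /phi /psi cK.
have phi_chi la : phi (chi A theta G m la) = chi A' theta G' m' la.
  by apply/funext => t; rewrite /phi /chi cE.
exists phi; split=> //; first by exists psi.
split.
- by move=> _ [la Pla <-]; exists la; rewrite ?phi_chi// -eqL.
- by move=> f g _ _; apply: (can_inj phiK).
- move=> _ [la Pla <-]; exists (chi A theta G m la); last exact: phi_chi.
  by exists la; rewrite // eqL.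
Qed.

Theorem theorem2p3 (R : realType) (n k : nat) (hn : (2 <= n)%N)
    (theta : 'rV[int]_n) (htheta : is_highest_root theta)
    (GA GC : 'M[R[i]]_n)
    (hGA : is_normalized_form A2n2 theta GA)
    (hGC : is_normalized_form Cn1 theta GC) :
  exists phi : fusion_ring A2n2 theta GA (2 * k).+1 ->
               fusion_ring Cn1 theta GC k,
    [/\ linear phi, GRing.monoid_morphism phi, bijective phi
      & set_bij (fusion_basis A2n2 theta GA (2 * k).+1)
                (fusion_basis Cn1 theta GC k) phi].
Proof.
have [theta_root _] := htheta.
have GAE := normalized_form_double _ _ _ theta_root hGA hGC.
have formA x y : inv_form GA x y = 2%:R * inv_form GC x y.
  by rewrite GAE /inv_form -scalemxAr -scalemxAl mxE.
have [symC invC nC] := hGC.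
have pairE G la : pairing (wt R la) (kappa_inv G (wt R theta)) =
    inv_form G (wt R la) (wt R theta).
  by rewrite /pairing /kappa_inv /inv_form mulmxA.
have eqL : level_weights theta GA (2 * k).+1 = level_weights theta GC k.
  (* On integers the partial order of [R[i]] restricts to the usual one, which reduces both level
     conditions to integer arithmetic. *)
  have lez (z : int) m : (z%:~R <= m%:R :> R[i]) = (z <= m%:Z).
    by rewrite pmulrn ler_int.
  apply/seteqP; split=> la [la_dom]; rewrite pairE ?formA => le_m;
    split=> //; move: le_m; rewrite pairE ?formA;
    have [z ->] := inv_form_root_int _ _ la invC theta_root nC;
    rewrite -(intrM _ 2) !lez; lia.
apply: fusion_ring_transport => //.
rewrite /Sigma eqL; apply: eq_imagel => la _; apply: torus_eq => mu /=.
rewrite /exp_form_fun formA; congr cexp.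
rewrite (_ : ((2 * k).+1 + (2 * n).+1 = 2 * (k + n.+1))%N); last by lia.
rewrite natrM; field.
by rewrite ?pnatr_eq0.
Qed.
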